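(* (Strong Normalisation) In the Fitch-style calculus for $IK$: if $\Gamma\vdash t:A$ is derivable, then $t$ is normalisable, i.e. there is an integer bounding the length of every reduction sequence $t\mapsto t_1\mapsto t_2\mapsto\cdots$ starting from $t$.
   Context: Types: $A,B ::= p \mid 1 \mid A\times B \mid A\to B \mid 0 \mid A+B \mid \Box A$ ($p$ atoms). Contexts: $\Gamma ::= \cdot \mid \Gamma,x:A \mid \Gamma,\bullet$ (variables distinct; $\bullet$ is a structural symbol called a lock). Terms: $x$, $\langle\rangle$, $\langle t,u\rangle$, $\pi_1 t$, $\pi_2 t$, $\lambda x.t$, $t\,u$, $\mathrm{inl}\,t$, $\mathrm{inr}\,t$, $\mathrm{case}\ s\ \mathrm{of}\ (x.t;\,y.u)$, $\mathrm{abort}\,t$, $\mathrm{shut}\,t$, $\mathrm{open}\,t$. Typing rules: (var) $\Gamma,x:A,\Gamma'\vdash x:A$ provided $\Gamma'$ contains no lock; (products) $\Gamma\vdash\langle\rangle:1$; from $\Gamma\vdash t:A$, $\Gamma\vdash u:B$ infer $\Gamma\vdash\langle t,u\rangle:A\times B$; from $\Gamma\vdash t:A_1\times A_2$ infer $\Gamma\vdash\pi_i t:A_i$; (functions) from $\Gamma,x:A\vdash t:B$ infer $\Gamma\vdash\lambda x.t:A\to B$; from $\Gamma\vdash t:A\to B$, $\Gamma\vdash u:A$ infer $\Gamma\vdash t\,u:B$; (sums) from $\Gamma\vdash t:A$ infer $\Gamma\vdash\mathrm{inl}\,t:A+B$; symmetrically for $\mathrm{inr}$; from $\Gamma\vdash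 s:A+B$, $\Gamma,x:A,\Gamma'\vdash t:C$, $\Gamma,y:B,\Gamma'\vdash u:C$ infer $\Gamma,\Gamma'\vdash\mathrm{case}\ s\ \mathrm{of}\ (x.t;\,y.u):C$ (any $\Gamma'$); from $\Gamma\vdash t:0$ infer $\Gamma,\Gamma'\vdash\mathrm{abort}\,t:A$ (any $\Gamma'$); (shut) from $\Gamma,\bullet\vdash t:A$ infer $\Gamma\vdash\mathrm{shut}\,t:\Box A$; (open) from $\Gamma\vdash t:\Box A$ infer $\Gamma,\bullet,\Gamma'\vdash\mathrm{open}\,t:A$ provided $\Gamma'$ contains no lock. Reduction: $\mapsto$ is the closure under all term formers of the rules $(\lambda x.t)\,u\mapsto t[u/x]$; $\pi_i\langle t_1,t_2\rangle\mapsto t_i$; $\mathrm{case}\ (\mathrm{inl}\,s)\ \mathrm{of}\ (x.t;\,y.u)\mapsto t[s/x]$; $\mathrm{case}\ (\mathrm{inr}\,s)\ \mathrm{of}\ (x.t;\,y.u)\mapsto u[s/y]$; $\mathrm{open}\,\mathrm{shut}\,t\mapsto t$; and the commuting conversions $E[\mathrm{case}\ s\ \mathrm{of}\ (x.t;\,y.u)]\mapsto\mathrm{case}\ s\ \mathrm{of}\ (x.E[t];\,y.E[u])$ and $E[\mathrm{abort}\,t]\mapsto\mathrm{abort}\,t$ for every elimination frame $E[-]$ among $[-]\,v$, $\pi_1[-]$, $\pi_2[-]$, $\mathrm{case}\ [-]\ \mathrm{of}\ (x'.t';\,y'.u')$, $\mathrm{abort}[-]$, $\mathrm{open}[-]$.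 *)

(* Defs.v *)
(* Standard library only. *)
From Stdlib Require Import List Arith.
Import ListNotations.

Set Implicit Arguments.

Inductive ty (Atom : Type) : Type :=
| TAtom (p : Atom)
| TUnit
| TProd (A B : ty Atom)
| TArr (A B : ty Atom)
| TVoid
| TSum (A B : ty Atom)
| TBox (A : ty Atom).

Arguments TUnit {Atom}.
Arguments TVoid {Atom}.

(* Terms modulo alpha-equivalence, in de Bruijn style: [Lam] binds index 0 in
   its body, and [Case s t u] binds index 0 in each of the branches [t], [u]. *)
Inductive term : Type :=
| Var (n : nat)
| Star
| Pair (t u : term)
| Fst (t : term)
| Snd (t : term)
| Lam (t : term)
| App (t u : term)
| Inl (t : term)
| Inr (t : term)
| Case (s t u : term)
| Abort (t : term)
| Shut (t : term)
| Open (t : term).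

(* Contexts are lists with the most recent entry at the head, so that the
   context written "G, G'" is the list [G' ++ G]. *)
Inductive entry (Atom : Type) : Type :=
| EVar (A : ty Atom)
| ELock.

Arguments ELock {Atom}.

Definition ctx (Atom : Type) : Type := list (entry Atom).

Definition lockfree (Atom : Type) (G : ctx Atom) : Prop := ~ In ELock G.

(* De Bruijn indices count the variables of a context and skip its locks. *)
Fixpoint nvars (Atom : Type) (G : ctx Atom) : nat :=
  match G with
  | [] => 0
  | EVar _ :: G' => S (nvars G')
  | ELock :: G' => nvars G'
  end.

Definition upren (r : nat -> nat) (k : nat) : nat :=
  match k with
  | 0 => 0
  | S k' => S (r k')
  end.

Fixpoint rename (r : nat -> nat) (t : term) : term :=
  match t with
  | Var k => Var (r k)
  | Star => Star
  | Pair t u => Pair (rename r t) (rename r u)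
  | Fst t => Fst (rename r t)
  | Snd t => Snd (rename r t)
  | Lam t => Lam (rename (upren r) t)
  | App t u => App (rename r t) (rename r u)
  | Inl t => Inl (rename r t)
  | Inr t => Inr (rename r t)
  | Case s t u => Case (rename r s) (rename (upren r) t) (rename (upren r) u)
  | Abort t => Abort (rename r t)
  | Shut t => Shut (rename r t)
  | Open t => Open (rename r t)
  end.

Definition upsubst (s : nat -> term) (k : nat) : term :=
  match k with
  | 0 => Var 0
  | S k' => rename S (s k')
  end.

Fixpoint subst (s : nat -> term) (t : term) : term :=
  match t with
  | Var k => s k
  | Star => Star
  | Pair t u => Pair (subst s t) (subst s u)
  | Fst t => Fst (subst s t)
  | Snd t => Snd (subst s t)
  | Lam t => Lam (subst (upsubst s) t)
  | App t u => App (subst s t) (subst s u)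
  | Inl t => Inl (subst s t)
  | Inr t => Inr (subst s t)
  | Case r t u => Case (subst s r) (subst (upsubst s) t) (subst (upsubst s) u)
  | Abort t => Abort (subst s t)
  | Shut t => Shut (subst s t)
  | Open t => Open (subst s t)
  end.

(* [subst0 u t] is t[u/x], where x is the variable of index 0 in [t]. *)
Definition subst0 (u t : term) : term :=
  subst (fun k => match k with 0 => u | S k' => Var k' end) t.

(* Weakening from G to "G, G'", where n is the number of variables of G'; with
   named variables it leaves the term unchanged. *)
Definition weaken (n : nat) (t : term) : term := rename (fun k => n + k) t.

(* In a branch typed in "G, x:A, G'", x has index n, the number of variables of
   G'.  Binding x in "G, G'" means giving it index 0: the n variables of G' move
   up by one and those of G keep their index. *)
Definition to_front (n k : nat) : nat :=
  match Nat.compare k n with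
  | Lt => S k
  | Eq => 0
  | Gt => k
  end.

Definition bind_at (n : nat) (t : term) : term := rename (to_front n) t.

Inductive has_type (Atom : Type) : ctx Atom -> term -> ty Atom -> Prop :=
| T_Var G G' A :
    lockfree G' ->
    has_type (G' ++ EVar A :: G) (Var (nvars G')) A
| T_Star G :
    has_type G Star TUnit
| T_Pair G t u A B :
    has_type G t A -> has_type G u B -> has_type G (Pair t u) (TProd A B)
| T_Fst G t A B :
    has_type G t (TProd A B) -> has_type G (Fst t) A
| T_Snd G t A B :
    has_type G t (TProd A B) -> has_type G (Snd t) B
| T_Lam G t A B :
    has_type (EVar A :: G) t B -> has_type G (Lam t) (TArr A B)
| T_App G t u A B :
    has_type G t (TArr A B) -> has_type G u A -> has_type G (App t u) B
| T_Inl G t A B :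
    has_type G t A -> has_type G (Inl t) (TSum A B)
| T_Inr G t A B :
    has_type G t B -> has_type G (Inr t) (TSum A B)
| T_Case G G' s t u A B C :
    has_type G s (TSum A B) ->
    has_type (G' ++ EVar A :: G) t C ->
    has_type (G' ++ EVar B :: G) u C ->
    has_type (G' ++ G)
      (Case (weaken (nvars G') s) (bind_at (nvars G') t) (bind_at (nvars G') u)) C
| T_Abort G G' t A :
    has_type G t TVoid ->
    has_type (G' ++ G) (Abort (weaken (nvars G') t)) A
| T_Shut G t A :
    has_type (ELock :: G) t A -> has_type G (Shut t) (TBox A)
| T_Open G G' t A :
    lockfree G' ->
    has_type G t (TBox A) ->
    has_type (G' ++ ELock :: G) (Open (weaken (nvars G') t)) A.

Inductive frame : Type :=
| FApp (v : term)
| FFst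
| FSnd
| FCase (t u : term)
| FAbort
| FOpen.

Definition plug (E : frame) (t : term) : term :=
  match E with
  | FApp v => App t v
  | FFst => Fst t
  | FSnd => Snd t
  | FCase t' u' => Case t t' u'
  | FAbort => Abort t
  | FOpen => Open t
  end.

(* A frame moved under one more binder. *)
Definition lift_frame (E : frame) : frame :=
  match E with
  | FApp v => FApp (rename S v)
  | FCase t u => FCase (rename (upren S) t) (rename (upren S) u)
  | FFst => FFst
  | FSnd => FSnd
  | FAbort => FAbort
  | FOpen => FOpen
  end.

Inductive step : term -> term -> Prop :=
| S_Beta t u : step (App (Lam t) u) (subst0 u t)
| S_FstPair t u : step (Fst (Pair t u)) t
| S_SndPair t u : step (Snd (Pair t u)) u
| S_CaseInl s t u : step (Case (Inl s) t u) (subst0 s t)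
| S_CaseInr s t u : step (Case (Inr s) t u) (subst0 s u)
| S_OpenShut t : step (Open (Shut t)) t
| S_CommCase E s t u :
    step (plug E (Case s t u))
         (Case s (plug (lift_frame E) t) (plug (lift_frame E) u))
| S_CommAbort E t : step (plug E (Abort t)) (Abort t)
| S_Pair1 t t' u : step t t' -> step (Pair t u) (Pair t' u)
| S_Pair2 t u u' : step u u' -> step (Pair t u) (Pair t u')
| S_Fst t t' : step t t' -> step (Fst t) (Fst t')
| S_Snd t t' : step t t' -> step (Snd t) (Snd t')
| S_Lam t t' : step t t' -> step (Lam t) (Lam t')
| S_App1 t t' u : step t t' -> step (App t u) (App t' u)
| S_App2 t u u' : step u u' -> step (App t u) (App t u')
| S_Inl t t' : step t t' -> step (Inl t) (Inl t')
| S_Inr t t' : step t t' -> step (Inr t) (Inr t')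
| S_Case1 s s' t u : step s s' -> step (Case s t u) (Case s' t u)
| S_Case2 s t t' u : step t t' -> step (Case s t u) (Case s t' u)
| S_Case3 s t u u' : step u u' -> step (Case s t u) (Case s t u')
| S_Abort t t' : step t t' -> step (Abort t) (Abort t')
| S_Shut t t' : step t t' -> step (Shut t) (Shut t')
| S_Open t t' : step t t' -> step (Open t) (Open t').

Inductive reduces_in : nat -> term -> term -> Prop :=
| R_Nil t : reduces_in 0 t t
| R_Cons n t t1 t' : step t t1 -> reduces_in n t1 t' -> reduces_in (S n) t t'.

(* An infinite reduction sequence has prefixes of every length, so the bound
   also excludes those. *)
Definition normalisable (t : term) : Prop :=
  exists N : nat, forall (n : nat) (t' : term), reduces_in n t t' -> n <= N.

(* Main.v *)
(** Strong normalisation by orthogonality against stacks of elimination frames.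
    Locks play no role: a context is read as the list of the types of its
    variables.  By recursion on a type one says which stacks are reducible; a
    term is reducible when plugging it into any reducible stack gives a
    normalisable term.  The commuting conversions are thereby absorbed into the
    stacks, so that only stacks applied to a variable or to an introduction form
    need an analysis of their reducts.  There, a conversion that moves a frame of
    the stack into the branches of a [Case] changes neither the contracted term
    nor the discarded branch seen through the stack, and shortens the stack.
    Carrying explicit bounds on reduction lengths, rather than accessibility,
    makes each of these analyses an induction on a sum of numbers and avoids any
    appeal to finite branching. *)
From Stdlib Require Import List Arith Lia Relation_Operators.
Require Import Defs.
Import ListNotations.

Set Implicit Arguments.

(** * Substitution *)

Lemma rename_ext (t : term) : forall r r',
  (forall k, r k = r' k) -> rename r t = rename r' t.
Proof.
  assert (U : forall r r', (forall k, r k = r' k) ->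
                           forall k, upren r k = upren r' k)
    by (intros r r' H [|k]; simpl; congruence).
  induction t; simpl; intros r r' H; f_equal; eauto.
Qed.

Lemma rename_rename (t : term) : forall r r',
  rename r (rename r' t) = rename (fun k => r (r' k)) t.
Proof.
  assert (U : forall r r' t, rename (fun k => upren r (upren r' k)) t
                             = rename (upren (fun k => r (r' k))) t)
    by (intros; apply rename_ext; intros [|k]; reflexivity).
  induction t; simpl; intros; f_equal;
    solve [auto | etransitivity; [eauto | apply U]].
Qed.

Lemma upsubst_ext (s s' : nat -> term) :
  (forall k, s k = s' k) -> forall k, upsubst s k = upsubst s' k.
Proof. intros H [|k]; simpl; congruence. Qed.

Lemma subst_ext (t : term) : forall s s',
  (forall k, s k = s' k) -> subst s t = subst s' t.
Proof.
  induction t; simpl; intros s s' H; f_equal; eauto using upsubst_ext.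
Qed.

Lemma subst_rename (t : term) : forall s r,
  subst s (rename r t) = subst (fun k => s (r k)) t.
Proof.
  assert (U : forall s r t, subst (fun k => upsubst s (upren r k)) t
                            = subst (upsubst (fun k => s (r k))) t)
    by (intros; apply subst_ext; intros [|k]; reflexivity).
  induction t; simpl; intros; f_equal;
    solve [auto | etransitivity; [eauto | apply U]].
Qed.

Lemma rename_subst (t : term) : forall r s,
  rename r (subst s t) = subst (fun k => rename r (s k)) t.
Proof.
  assert (U : forall r s t, subst (fun k => rename (upren r) (upsubst s k)) t
                            = subst (upsubst (fun k => rename r (s k))) t)
    by (intros; apply subst_ext; intros [|k]; simpl; rewrite ?rename_rename;
        reflexivity).
  induction t; simpl; intros; f_equal;
    solve [auto | etransitivity; [eauto | apply U]].
Qed.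

(** Under a binder [s] has to be commuted past a shift, which takes both mixed laws above. *)
Lemma subst_subst (t : term) : forall s s',
  subst s (subst s' t) = subst (fun k => subst s (s' k)) t.
Proof.
  assert (U : forall s s' t, subst (fun k => subst (upsubst s) (upsubst s' k)) t
                             = subst (upsubst (fun k => subst s (s' k))) t)
    by (intros; apply subst_ext; intros [|k]; simpl;
        rewrite ?subst_rename, ?rename_subst; reflexivity).
  induction t; simpl; intros; f_equal;
    solve [auto | etransitivity; [eauto | apply U]].
Qed.

Lemma subst_Var (t : term) : subst Var t = t.
Proof.
  assert (U : forall t, subst (upsubst Var) t = subst Var t)
    by (intros; apply subst_ext; intros [|k]; reflexivity).
  induction t; simpl; rewrite ?U; congruence.
Qed.

Lemma rename_as_subst (r : nat -> nat) (t : term) :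
  rename r t = subst (fun k => Var (r k)) t.
Proof. rewrite <- (subst_Var (rename r t)). apply subst_rename. Qed.

Definition scons (u : term) (s : nat -> term) (k : nat) : term :=
  match k with 0 => u | S k' => s k' end.

Lemma subst0_upsubst (u : term) (s : nat -> term) (t : term) :
  subst0 u (subst (upsubst s) t) = subst (scons u s) t.
Proof.
  unfold subst0. rewrite subst_subst. apply subst_ext.
  intros [|k]; simpl; auto. rewrite subst_rename. apply subst_Var.
Qed.

Lemma subst_subst0 (s : nat -> term) (u t : term) :
  subst s (subst0 u t) = subst0 (subst s u) (subst (upsubst s) t).
Proof.
  rewrite subst0_upsubst. unfold subst0. rewrite subst_subst.
  apply subst_ext. intros [|k]; reflexivity.
Qed.

Definition subst_frame (s : nat -> term) (E : frame) : frame :=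
  match E with
  | FApp v => FApp (subst s v)
  | FCase t u => FCase (subst (upsubst s) t) (subst (upsubst s) u)
  | FFst => FFst
  | FSnd => FSnd
  | FAbort => FAbort
  | FOpen => FOpen
  end.

Lemma subst_plug (s : nat -> term) (E : frame) (t : term) :
  subst s (plug E t) = plug (subst_frame s E) (subst s t).
Proof. destruct E; reflexivity. Qed.

Lemma subst_frame_lift (s : nat -> term) (E : frame) :
  subst_frame (upsubst s) (lift_frame E) = lift_frame (subst_frame s E).
Proof.
  destruct E; simpl; try reflexivity; f_equal; rewrite subst_rename, rename_subst;
    apply subst_ext; intros k; try reflexivity.
  all: destruct k; simpl; rewrite ?rename_rename; reflexivity.
Qed.

(** The lifted frame avoids index 0, so the substitution undoes the lift. This is why a commuting
    conversion preserves an instantiated branch seen through a stack. *)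
Lemma subst0_plug_lift (a : term) (E : frame) (t : term) :
  subst0 a (plug (lift_frame E) t) = plug E (subst0 a t).
Proof.
  unfold subst0 at 1. rewrite subst_plug. f_equal.
  destruct E; simpl; try reflexivity; f_equal; rewrite subst_rename;
    (etransitivity; [|apply subst_Var]); apply subst_ext; intros [|k]; reflexivity.
Qed.

Lemma step_subst (t t' : term) :
  step t t' -> forall s, step (subst s t) (subst s t').
Proof.
  induction 1; intros r; rewrite ?subst_plug; simpl;
    rewrite ?subst_subst0, ?subst_plug, ?subst_frame_lift;
    constructor; auto.
Qed.

Lemma step_rename (r : nat -> nat) (t t' : term) :
  step t t' -> step (rename r t) (rename r t').
Proof. rewrite !rename_as_subst. intros; apply step_subst; auto. Qed.

(** * Reduction sequences in contexts and under substitution *)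

Notation steps := (clos_refl_trans term step).

Lemma steps_map (f : term -> term) :
  (forall t t', step t t' -> step (f t) (f t')) ->
  forall t t', steps t t' -> steps (f t) (f t').
Proof.
  intros Hf t t'. induction 1; eauto using rt_step, rt_refl, rt_trans.
Qed.

Lemma steps_map2 (f : term -> term -> term) :
  (forall t t' u, step t t' -> step (f t u) (f t' u)) ->
  (forall t u u', step u u' -> step (f t u) (f t u')) ->
  forall t t' u u', steps t t' -> steps u u' -> steps (f t u) (f t' u').
Proof.
  intros H1 H2 t t' u u' Ht Hu. apply rt_trans with (f t' u).
  - apply (steps_map (fun z => f z u)); auto.
  - apply (steps_map (f t')); auto.
Qed.

(** A variable may occur any number of times in [t], so one step in its value becomes several or
    none. *)
Lemma steps_subst (t : term) : forall s s',
  (forall k, steps (s k) (s' k)) -> steps (subst s t) (subst s' t).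
Proof.
  assert (U : forall s s', (forall k, steps (s k) (s' k)) ->
                           forall k, steps (upsubst s k) (upsubst s' k)).
  { intros s s' H [|k]; simpl; [apply rt_refl|].
    apply steps_map; auto using step_rename. }
  induction t; simpl; intros s s' H; auto using rt_refl.
  all: try (apply steps_map; [intros; constructor; assumption | auto]; fail).
  all: try (apply steps_map2; [intros; constructor; assumption
                              |intros; constructor; assumption | auto | auto]; fail).
  apply rt_trans with (Case (subst s' t1) (subst (upsubst s) t2)
                            (subst (upsubst s) t3)).
  - apply (steps_map (fun z => Case z _ _)); [intros; constructor|]; auto.
  - apply steps_map2; auto; intros; constructor; assumption.
Qed.

Lemma step_subst0 (u t t' : term) :
  step t t' -> step (subst0 u t) (subst0 u t').
Proof. intros; apply step_subst; assumption. Qed.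

Lemma steps_subst0 (u u' t : term) :
  step u u' -> steps (subst0 u t) (subst0 u' t).
Proof. intros. apply steps_subst. intros [|k]; auto using rt_step, rt_refl. Qed.

(** * Bounds on the length of reductions *)

Definition bounded (N : nat) (t : term) : Prop :=
  forall n t', reduces_in n t t' -> n <= N.

Lemma normalisable_bounded (t : term) :
  normalisable t <-> exists N, bounded N t.
Proof. reflexivity. Qed.

Lemma bounded_mono (m n : nat) (t : term) :
  m <= n -> bounded m t -> bounded n t.
Proof. intros H B k t' R. apply B in R. lia. Qed.

Lemma bounded_intro (N : nat) (t : term) :
  (forall t', step t t' -> bounded N t') -> bounded (S N) t.
Proof.
  intros H n t' R. destruct R as [|n t t1 t' s R]; [lia|].
  apply (H t1 s) in R. lia.
Qed.

Lemma bounded_step (N : nat) (t t' : term) :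
  bounded N t -> step t t' -> exists M, N = S M /\ bounded M t'.
Proof.
  intros B s.
  assert (H : 1 <= N) by (apply (B 1 t'); econstructor; [eassumption|constructor]).
  exists (pred N). split; [lia|]. intros n t'' R.
  assert (S n <= N) by (apply (B (S n) t''); econstructor; eassumption). lia.
Qed.

Lemma bounded_steps (N : nat) (t t' : term) :
  steps t t' -> bounded N t -> bounded N t'.
Proof.
  induction 1; auto. intros B.
  destruct (bounded_step B H) as (M & -> & B'). apply bounded_mono with M; auto.
Qed.

(** A reduction of [t] is carried by [f] to one of [f t] of the same length. *)
Lemma bounded_map_inv (f : term -> term) :
  (forall t t', step t t' -> step (f t) (f t')) ->
  forall N t, bounded N (f t) -> bounded N t.
Proof.
  intros Hf N t B n t' R. revert N B.
  induction R as [|n t t1 t' s R IH]; intros N B; [lia|].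
  destruct (bounded_step B (Hf _ _ s)) as (M & -> & B'). apply IH in B'. lia.
Qed.

(** * Stacks of elimination frames *)

(** The head of the list is the innermost frame, the one that meets [t] first. *)
Definition plugs (K : list frame) (t : term) : term :=
  fold_left (fun t E => plug E t) K t.

Inductive fstep : frame -> frame -> Prop :=
| FS_App v v' : step v v' -> fstep (FApp v) (FApp v')
| FS_Case1 t t' u : step t t' -> fstep (FCase t u) (FCase t' u)
| FS_Case2 t u u' : step u u' -> fstep (FCase t u) (FCase t u').

(* The reductions of [plugs K t] that are uniform in [t]. *)
Inductive kstep : list frame -> list frame -> Prop :=
| KS_Frame E E' K : fstep E E' -> kstep (E :: K) (E' :: K)
| KS_Tail E K K' : kstep K K' -> kstep (E :: K) (E :: K')
| KS_Case t u E K :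
    kstep (FCase t u :: E :: K)
          (FCase (plug (lift_frame E) t) (plug (lift_frame E) u) :: K)
| KS_Abort E K : kstep (FAbort :: E :: K) (FAbort :: K).

(** Contractions between the innermost frame and its content. The frame is consumed, and the rest of
    the stack then surrounds the third argument. *)
Inductive root : frame -> term -> term -> Prop :=
| Rt_Beta t u : root (FApp u) (Lam t) (subst0 u t)
| Rt_Fst t u : root FFst (Pair t u) t
| Rt_Snd t u : root FSnd (Pair t u) u
| Rt_Inl s t u : root (FCase t u) (Inl s) (subst0 s t)
| Rt_Inr s t u : root (FCase t u) (Inr s) (subst0 s u)
| Rt_Open t : root FOpen (Shut t) t
| Rt_Case E s t u :
    root E (Case s t u) (Case s (plug (lift_frame E) t) (plug (lift_frame E) u))
| Rt_Abort E t : root E (Abort t) (Abort t).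

Lemma plug_step (E : frame) (t t' : term) :
  step t t' -> step (plug E t) (plug E t').
Proof. destruct E; simpl; intros; constructor; assumption. Qed.

Lemma plugs_step (K : list frame) : forall t t',
  step t t' -> step (plugs K t) (plugs K t').
Proof. induction K; simpl; auto using plug_step. Qed.

Lemma kstep_step (K K' : list frame) :
  kstep K K' -> forall t, step (plugs K t) (plugs K' t).
Proof.
  induction 1; intros s; simpl; auto.
  - apply plugs_step. destruct H; simpl; constructor; assumption.
  - apply plugs_step. apply (S_CommCase E s t u).
  - apply plugs_step. apply (S_CommAbort E s).
Qed.

(** Commuting conversions drop one frame and all other stack steps keep their number, so the length
    can enter a measure. *)
Lemma kstep_length (K K' : list frame) :
  kstep K K' -> length K' <= length K.
Proof. induction 1; simpl; lia. Qed.

Lemma plug_step_inv (E : frame) (t v : term) :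
  step (plug E t) v ->
  (exists t', step t t' /\ v = plug E t') \/
  (exists E', fstep E E' /\ v = plug E' t) \/
  root E t v.
Proof.
  intros H. remember (plug E t) as w eqn:e.
  destruct H as [| | | | | |E0 ? ? ?|E0 ?| | | | | | | | | | | | | | | ];
    (* The head constructor determines the frame, so the frame of a commuting conversion is [E]
       itself. *)
    try (assert (E0 = E) by
           (destruct E0, E; simpl in e; inversion e; subst; reflexivity));
    destruct E; simpl in e; inversion e; subst;
    try (right; right; constructor; fail);
    try (left; eexists; split; [eassumption|reflexivity]);
    try (right; left; eexists; split; [constructor; eassumption|reflexivity]).
  all: simpl in *; try match goal with H : _ = _ |- _ => inversion H; subst end;
    right; right; constructor.
Qed.

Lemma plugs_step_inv (K : list frame) : forall t v,
  step (plugs K t) v ->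
  (exists t', step t t' /\ v = plugs K t') \/
  (exists K', kstep K K' /\ v = plugs K' t) \/
  (exists E K' t', K = E :: K' /\ root E t t' /\ v = plugs K' t').
Proof.
  induction K as [|E K IH]; simpl; intros t v H; [eauto|].
  destruct (IH _ _ H) as [(t' & s & ->)|[(K' & s & ->)|(E' & K' & t' & -> & s & ->)]].
  - destruct (plug_step_inv _ _ s) as [(t'' & s' & ->)|[(E' & s' & ->)|s']].
    + eauto.
    + right; left. exists (E' :: K). split; [constructor|]; auto.
    + right; right. exists E, K, t'. auto.
  - right; left. exists (E :: K'). split; [constructor|]; auto.
  - right; left.
    (* [plug E t] is an elimination, so the next frame contracts with it only by a commuting
       conversion. *)
    destruct E; simpl in s; inversion s; subst.
    + eexists; split; [apply KS_Case|reflexivity].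
    + eexists; split; [apply KS_Abort|reflexivity].
Qed.

(** * Stacks applied to variables and introduction forms *)

(** A variable or introduction form is never [plug E _], which rules out the commuting
    conversions. *)
Ltac invert_intro H :=
  inversion H; subst;
  try match goal with e : plug ?E _ = _ |- _ => destruct E; discriminate e end;
  eauto.

Lemma step_Var_inv (x : nat) (v : term) : ~ step (Var x) v.
Proof. intros H. invert_intro H. Qed.

Lemma step_Star_inv (v : term) : ~ step Star v.
Proof. intros H. invert_intro H. Qed.

Lemma step_Pair_inv (t u v : term) :
  step (Pair t u) v ->
  (exists t', step t t' /\ v = Pair t' u) \/
  (exists u', step u u' /\ v = Pair t u').
Proof. intros H. invert_intro H. Qed.

Lemma step_Lam_inv (t v : term) :
  step (Lam t) v -> exists t', step t t' /\ v = Lam t'.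
Proof. intros H. invert_intro H. Qed.

Lemma step_Inl_inv (t v : term) :
  step (Inl t) v -> exists t', step t t' /\ v = Inl t'.
Proof. intros H. invert_intro H. Qed.

Lemma step_Inr_inv (t v : term) :
  step (Inr t) v -> exists t', step t t' /\ v = Inr t'.
Proof. intros H. invert_intro H. Qed.

Lemma step_Shut_inv (t v : term) :
  step (Shut t) v -> exists t', step t t' /\ v = Shut t'.
Proof. intros H. invert_intro H. Qed.

Ltac weaken_bound H := eapply bounded_mono; [|exact H]; lia.

Ltac use_step B s :=
  let n := fresh "n" in
  destruct (bounded_step B s) as (n & -> & ?).

(* The branches are measured through the stack with arbitrary [a] and [b]
   substituted, since [K[t[a]]] is invariant when a frame of [K] moves into
   [t]. *)
Lemma bounded_case_aux (N : nat) : forall K t u a b s n1 n2 n3,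
  bounded n1 (plugs K (subst0 a t)) ->
  bounded n2 (plugs K (subst0 b u)) ->
  bounded n3 s ->
  ((exists x, s = Var x) \/ s = Inl a \/ s = Inr b) ->
  n1 + n2 + n3 + length K < N ->
  bounded N (plugs (FCase t u :: K) s).
Proof.
  induction N as [|N IH]; intros K t u a b s n1 n2 n3 B1 B2 B3 Hs L; [lia|].
  apply bounded_intro. intros v Hv.
  destruct (plugs_step_inv _ _ Hv)
    as [(s' & st & ->)|[(K' & st & ->)|(E & K' & s' & e & st & ->)]].
  - use_step B3 st.
    destruct Hs as [[x ->]|[-> | ->]]; [destruct (step_Var_inv st)| |].
    + apply step_Inl_inv in st. destruct st as (t' & st & ->).
      (* The branch may duplicate or erase its argument, so [n1] is only preserved; the decrease
         comes from [n3]. *)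
      eapply IH with (a := t') (b := b) (n1 := n1); eauto; [|lia].
      eapply bounded_steps; [|exact B1]. apply steps_map; auto using plugs_step.
      apply steps_subst0; assumption.
    + apply step_Inr_inv in st. destruct st as (t' & st & ->).
      eapply IH with (a := a) (b := t') (n2 := n2); eauto; [|lia].
      eapply bounded_steps; [|exact B2]. apply steps_map; auto using plugs_step.
      apply steps_subst0; assumption.
  - inversion st as [E E' K0 f|E K0 K1 k|t0 u0 E K0| ]; subst.
    + inversion f as [|t0 t' u0 st'|t0 u0 u' st']; subst.
      * use_step B1 (plugs_step K (step_subst0 a st')).
        eapply IH; eauto; lia.
      * use_step B2 (plugs_step K (step_subst0 b st')).
        eapply IH; eauto; lia.
    + use_step B1 (kstep_step k (subst0 a t)).
      use_step B2 (kstep_step k (subst0 b u)).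
      apply kstep_length in k. eapply IH; eauto; lia.
    (* All three bounds are unchanged here; the shorter stack alone lowers the sum. *)
    + simpl in L. eapply IH with (a := a) (b := b); eauto;
        [rewrite subst0_plug_lift; exact B1
        |rewrite subst0_plug_lift; exact B2|lia].
  - inversion e; subst. destruct Hs as [[x ->]|[-> | ->]]; inversion st; subst.
    + weaken_bound B1.
    + weaken_bound B2.
Qed.

(** An injection fixes the argument of the selected branch. The other branch can still reduce before
    the contraction, so some argument must witness that it normalises through [K]. *)
Lemma normalisable_case (K : list frame) (t u a b s : term) :
  normalisable (plugs K (subst0 a t)) ->
  normalisable (plugs K (subst0 b u)) ->
  normalisable s ->
  ((exists x, s = Var x) \/ s = Inl a \/ s = Inr b) ->
  normalisable (plugs (FCase t u :: K) s).
Proof.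
  intros [n1 B1] [n2 B2] [n3 B3] Hs.
  eexists. eapply bounded_case_aux; eauto.
Qed.

(** The body may erase [u], whose reductions are therefore counted separately. Steps of the body or
    of [K] are charged to the contracted term. *)
Lemma normalisable_beta (K : list frame) (t u : term) :
  normalisable (plugs K (subst0 u t)) -> normalisable u ->
  normalisable (plugs (FApp u :: K) (Lam t)).
Proof.
  intros [n1 B1] [n2 B2].
  apply normalisable_bounded. exists (S (n1 + n2)).
  assert (L : n1 + n2 < S (n1 + n2)) by lia. revert L.
  (* [N] bounds the reductions and, strictly, the sum [n1 + n2], so a single induction on [N] covers
     all reducts. *)
  generalize (S (n1 + n2)) as N. intros N. revert K t u n1 n2 B1 B2.
  induction N as [|N IH]; intros K t u n1 n2 B1 B2 L; [lia|].
  apply bounded_intro. intros v Hv.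
  destruct (plugs_step_inv _ _ Hv)
    as [(s' & st & ->)|[(K' & st & ->)|(E & K' & s' & e & st & ->)]].
  - apply step_Lam_inv in st. destruct st as (t' & st' & ->).
    use_step B1 (plugs_step K (step_subst0 u st')). eapply IH; eauto; lia.
  - inversion st as [E E' K0 f|E K0 K1 k| | ]; subst.
    + inversion f as [v0 v' st'| | ]; subst. use_step B2 st'.
      eapply IH with (n1 := n1); eauto; [|lia]. eapply bounded_steps; [|exact B1].
      apply steps_map; auto using plugs_step. apply steps_subst0; assumption.
    + use_step B1 (kstep_step k (subst0 u t)). eapply IH; eauto; lia.
  - inversion e; subst. inversion st; subst. weaken_bound B1.
Qed.

Lemma normalisable_fst_pair (K : list frame) (t u : term) :
  normalisable (plugs K t) -> normalisable u ->
  normalisable (plugs (FFst :: K) (Pair t u)).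
Proof.
  intros [n1 B1] [n2 B2].
  apply normalisable_bounded. exists (S (n1 + n2)).
  assert (L : n1 + n2 < S (n1 + n2)) by lia. revert L.
  generalize (S (n1 + n2)) as N. intros N. revert K t u n1 n2 B1 B2.
  induction N as [|N IH]; intros K t u n1 n2 B1 B2 L; [lia|].
  apply bounded_intro. intros v Hv.
  destruct (plugs_step_inv _ _ Hv)
    as [(s' & st & ->)|[(K' & st & ->)|(E & K' & s' & e & st & ->)]].
  - apply step_Pair_inv in st.
    destruct st as [(t' & st' & ->)|(u' & st' & ->)].
    + use_step B1 (plugs_step K st'). eapply IH; eauto; lia.
    + use_step B2 st'. eapply IH; eauto; lia.
  - inversion st as [E E' K0 f|E K0 K1 k| | ]; subst; [inversion f|].
    use_step B1 (kstep_step k t). eapply IH; eauto; lia.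
  - inversion e; subst. inversion st; subst. weaken_bound B1.
Qed.

Lemma normalisable_snd_pair (K : list frame) (t u : term) :
  normalisable t -> normalisable (plugs K u) ->
  normalisable (plugs (FSnd :: K) (Pair t u)).
Proof.
  intros [n1 B1] [n2 B2].
  apply normalisable_bounded. exists (S (n1 + n2)).
  assert (L : n1 + n2 < S (n1 + n2)) by lia. revert L.
  generalize (S (n1 + n2)) as N. intros N. revert K t u n1 n2 B1 B2.
  induction N as [|N IH]; intros K t u n1 n2 B1 B2 L; [lia|].
  apply bounded_intro. intros v Hv.
  destruct (plugs_step_inv _ _ Hv)
    as [(s' & st & ->)|[(K' & st & ->)|(E & K' & s' & e & st & ->)]].
  - apply step_Pair_inv in st.
    destruct st as [(t' & st' & ->)|(u' & st' & ->)].
    + use_step B1 st'. eapply IH; eauto; lia.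
    + use_step B2 (plugs_step K st'). eapply IH; eauto; lia.
  - inversion st as [E E' K0 f|E K0 K1 k| | ]; subst; [inversion f|].
    use_step B2 (kstep_step k u). eapply IH; eauto; lia.
  - inversion e; subst. inversion st; subst. weaken_bound B2.
Qed.

Lemma normalisable_open_shut (K : list frame) (t : term) :
  normalisable (plugs K t) -> normalisable (plugs (FOpen :: K) (Shut t)).
Proof.
  intros [n B].
  apply normalisable_bounded. exists (S n).
  assert (L : n < S n) by lia. revert L.
  generalize (S n) as N. intros N. revert K t n B.
  induction N as [|N IH]; intros K t n B L; [lia|].
  apply bounded_intro. intros v Hv.
  destruct (plugs_step_inv _ _ Hv)
    as [(s' & st & ->)|[(K' & st & ->)|(E & K' & s' & e & st & ->)]].
  - apply step_Shut_inv in st. destruct st as (t' & st' & ->).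
    use_step B (plugs_step K st'). eapply IH; eauto; lia.
  - inversion st as [E E' K0 f|E K0 K1 k| | ]; subst; [inversion f|].
    use_step B (kstep_step k t). eapply IH; eauto; lia.
  - inversion e; subst. inversion st; subst. weaken_bound B.
Qed.

(** * Variables under a stack *)

Lemma normalisable_Var (x : nat) : normalisable (Var x).
Proof.
  exists 1. apply bounded_intro. intros v H. destruct (step_Var_inv H).
Qed.

(** The frames that contain no term and absorb no later frame; [FAbort] fails the second
    condition. *)
Definition inert (E : frame) : Prop := E = FFst \/ E = FSnd \/ E = FOpen.

(** A variable contracts with no frame, so only steps of [K] remain. They are uniform in the plugged
    term, so a bound over any [t] transfers. *)
Lemma normalisable_inert_Var (E : frame) (K : list frame) (t : term) (x : nat) :
  inert E -> normalisable (plugs K t) -> normalisable (plugs (E :: K) (Var x)).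
Proof.
  intros HE [n B].
  apply normalisable_bounded. exists (S n).
  assert (L : n < S n) by lia. revert L.
  generalize (S n) as N. intros N. revert K n B.
  induction N as [|N IH]; intros K n B L; [lia|].
  apply bounded_intro. intros v Hv.
  destruct (plugs_step_inv _ _ Hv)
    as [(s' & st & ->)|[(K' & st & ->)|(E' & K' & s' & e & st & ->)]].
  - destruct (step_Var_inv st).
  - inversion st as [E0 E' K0 f|E0 K0 K1 k| | ]; subst;
      try (destruct HE as [HE|[HE|HE]]; discriminate).
    + destruct HE as [-> |[-> | ->]]; inversion f.
    + use_step B (kstep_step k t). eapply IH; eauto; lia.
  - inversion st.
Qed.

Lemma normalisable_app_Var (K : list frame) (t u : term) (x : nat) :
  normalisable (plugs K t) -> normalisable u ->
  normalisable (plugs (FApp u :: K) (Var x)).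
Proof.
  intros [n1 B1] [n2 B2].
  apply normalisable_bounded. exists (S (n1 + n2)).
  assert (L : n1 + n2 < S (n1 + n2)) by lia. revert L.
  generalize (S (n1 + n2)) as N. intros N. revert K u n1 n2 B1 B2.
  induction N as [|N IH]; intros K u n1 n2 B1 B2 L; [lia|].
  apply bounded_intro. intros v Hv.
  destruct (plugs_step_inv _ _ Hv)
    as [(s' & st & ->)|[(K' & st & ->)|(E & K' & s' & e & st & ->)]].
  - destruct (step_Var_inv st).
  - inversion st as [E E' K0 f|E K0 K1 k| | ]; subst.
    + inversion f as [v0 v' st'| | ]; subst. use_step B2 st'.
      eapply IH; eauto; lia.
    + use_step B1 (kstep_step k t). eapply IH; eauto; lia.
  - inversion st.
Qed.

Lemma normalisable_abort_Var (K : list frame) (t : term) (x : nat) :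
  normalisable (plugs K t) -> normalisable (plugs (FAbort :: K) (Var x)).
Proof.
  intros [n B].
  apply normalisable_bounded. exists (S (n + length K)).
  assert (L : n + length K < S (n + length K)) by lia. revert L.
  generalize (S (n + length K)) as N. intros N. revert K t n B.
  induction N as [|N IH]; intros K t n B L; [lia|].
  apply bounded_intro. intros v Hv.
  destruct (plugs_step_inv _ _ Hv)
    as [(s' & st & ->)|[(K' & st & ->)|(E & K' & s' & e & st & ->)]].
  - destruct (step_Var_inv st).
  - inversion st as [E E' K0 f|E K0 K1 k| |E K0]; subst; [inversion f| |].
    + use_step B (kstep_step k t). apply kstep_length in k.
      eapply IH; eauto; lia.
    (* The absorbed frame [E] moves onto the witness [t], so the bounded term is the same as before
       and the decrease is in the length of the stack. *)
    + simpl in L. eapply IH with (t := plug E t); [exact B|lia].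
  - inversion st.
Qed.

(** * Introduction forms without a stack *)

Lemma normalisable_Star : normalisable Star.
Proof.
  exists 1. apply bounded_intro. intros v H. destruct (step_Star_inv H).
Qed.

Lemma normalisable_map (f : term -> term) :
  (forall t v, step (f t) v -> exists t', step t t' /\ v = f t') ->
  forall t, normalisable t -> normalisable (f t).
Proof.
  intros Hf t [n B].
  apply normalisable_bounded. exists (S n).
  assert (L : n < S n) by lia. revert L.
  generalize (S n) as N. intros N. revert t n B.
  induction N as [|N IH]; intros t n B L; [lia|].
  apply bounded_intro. intros v Hv.
  destruct (Hf _ _ Hv) as (t' & st & ->). use_step B st. eapply IH; eauto; lia.
Qed.

Lemma normalisable_Lam (t : term) : normalisable t -> normalisable (Lam t).
Proof. apply normalisable_map, step_Lam_inv. Qed.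

Lemma normalisable_Inl (t : term) : normalisable t -> normalisable (Inl t).
Proof. apply normalisable_map, step_Inl_inv. Qed.

Lemma normalisable_Inr (t : term) : normalisable t -> normalisable (Inr t).
Proof. apply normalisable_map, step_Inr_inv. Qed.

Lemma normalisable_Shut (t : term) : normalisable t -> normalisable (Shut t).
Proof. apply normalisable_map, step_Shut_inv. Qed.

(** [Fst (Pair t u)] normalises, and every reduction of the pair also takes place under [Fst]. *)
Lemma normalisable_Pair (t u : term) :
  normalisable t -> normalisable u -> normalisable (Pair t u).
Proof.
  intros Ht Hu. destruct (@normalisable_fst_pair [] t u Ht Hu) as [n B].
  exists n. apply (bounded_map_inv Fst) in B; auto using S_Fst.
Qed.

(** * Reducibility *)

(* A frame [FAbort] may be followed by any stack that is normalising at all,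
   because its result type is arbitrary. *)
Fixpoint redK (Atom : Type) (A : ty Atom) (K : list frame) : Prop :=
  K = [] \/
  match A with
  | TAtom _ => False
  | TUnit => False
  | TProd A B =>
      exists K', (K = FFst :: K' /\ redK A K') \/ (K = FSnd :: K' /\ redK B K')
  | TArr A B =>
      exists u K', K = FApp u :: K' /\
        (forall L, redK A L -> normalisable (plugs L u)) /\ redK B K'
  | TVoid => exists t K', K = FAbort :: K' /\ normalisable (plugs K' t)
  | TSum A B =>
      exists t u K', K = FCase t u :: K' /\
        (forall a, (forall L, redK A L -> normalisable (plugs L a)) ->
                   normalisable (plugs K' (subst0 a t))) /\
        (forall b, (forall L, redK B L -> normalisable (plugs L b)) ->
                   normalisable (plugs K' (subst0 b u)))
  | TBox A => exists K', K = FOpen :: K' /\ redK A K'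
  end.

(** The orthogonal of the reducible stacks. [redK] contains this formula unfolded, since its
    recursion on types comes first. *)
Definition red (Atom : Type) (A : ty Atom) (t : term) : Prop :=
  forall K, redK A K -> normalisable (plugs K t).

Lemma redK_nil (Atom : Type) (A : ty Atom) : redK A [].
Proof. destruct A; left; reflexivity. Qed.

Lemma red_normalisable (Atom : Type) (A : ty Atom) (t : term) :
  red A t -> normalisable t.
Proof. intros H. apply (H []), redK_nil. Qed.

(** By induction on the type, variables at the component types are reducible. They supply terms over
    which the rest of the stack normalises, and arguments for the branches of a case frame. *)
Lemma red_Var (Atom : Type) (A : ty Atom) : forall x, red A (Var x).
Proof.
  induction A as [p| |A IHA B IHB|A IHA B IHB| |A IHA B IHB|A IHA];
    intros x K [-> |HK]; try apply normalisable_Var; try contradiction.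
  - destruct HK as (K' & [[-> HK]|[-> HK]]).
    + eapply normalisable_inert_Var with (t := Var 0); [|apply IHA; auto].
      unfold inert; auto.
    + eapply normalisable_inert_Var with (t := Var 0); [|apply IHB; auto].
      unfold inert; auto.
  - destruct HK as (u & K' & -> & Hu & HK).
    apply normalisable_app_Var with (t := Var 0).
    + apply IHB; auto.
    + apply (Hu []), redK_nil.
  - destruct HK as (t & K' & -> & HK). eapply normalisable_abort_Var; eauto.
  - destruct HK as (t & u & K' & -> & Ht & Hu).
    apply normalisable_case with (a := Var 0) (b := Var 0);
      eauto using normalisable_Var; [apply Ht, IHA | apply Hu, IHB].
  - destruct HK as (K' & -> & HK).
    eapply normalisable_inert_Var with (t := Var 0); [|apply IHA; auto].
    unfold inert; auto.
Qed.

Lemma red_Lam (Atom : Type) (A B : ty Atom) (t : term) :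
  (forall u, red A u -> red B (subst0 u t)) -> red (TArr A B) (Lam t).
Proof.
  intros H K [-> |(u & K' & -> & Hu & HK)].
  - apply normalisable_Lam.
    (* [subst0 (Var 0)] may identify two variables but preserves the length of reductions, so its
       bound passes to the body. *)
    destruct (red_normalisable (H (Var 0) (red_Var A 0))) as [n Bn].
    exists n. apply (bounded_map_inv (subst0 (Var 0))) in Bn;
      auto using step_subst0.
  - apply normalisable_beta; [|apply (Hu []), redK_nil]. apply H; auto.
Qed.

Lemma red_Inl (Atom : Type) (A B : ty Atom) (t : term) :
  red A t -> red (TSum A B) (Inl t).
Proof.
  intros H K [-> |(t1 & u1 & K' & -> & Ht & Hu)].
  - apply normalisable_Inl. apply (red_normalisable H).
  (* Any reducible term can instantiate the branch not taken. *)
  - apply normalisable_case with (a := t) (b := Var 0); auto.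
    + apply Hu, red_Var.
    + apply normalisable_Inl, (red_normalisable H).
Qed.

Lemma red_Inr (Atom : Type) (A B : ty Atom) (t : term) :
  red B t -> red (TSum A B) (Inr t).
Proof.
  intros H K [-> |(t1 & u1 & K' & -> & Ht & Hu)].
  - apply normalisable_Inr. apply (red_normalisable H).
  - apply normalisable_case with (a := Var 0) (b := t); auto.
    + apply Ht, red_Var.
    + apply normalisable_Inr, (red_normalisable H).
Qed.

(** The case frame in front of a stack reducible at [C] is a stack reducible at the sum, by the
    clause of [redK]. The other eliminations follow the same pattern. *)
Lemma red_Case (Atom : Type) (A B C : ty Atom) (s t u : term) :
  red (TSum A B) s ->
  (forall a, red A a -> red C (subst0 a t)) ->
  (forall b, red B b -> red C (subst0 b u)) ->
  red C (Case s t u).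
Proof.
  intros Hs Ht Hu K HK. apply (Hs (FCase t u :: K)).
  right. exists t, u, K. split; auto.
  split; intros a Ha; [apply Ht | apply Hu]; auto.
Qed.

Lemma red_Abort (Atom : Type) (A : ty Atom) (t : term) :
  red (@TVoid Atom) t -> red A (Abort t).
Proof.
  intros Ht K HK. apply (Ht (FAbort :: K)).
  right. exists (Var 0), K. split; auto. apply (red_Var A); auto.
Qed.

(** * The fundamental lemma *)

Fixpoint var_types (Atom : Type) (G : ctx Atom) : list (ty Atom) :=
  match G with
  | [] => []
  | EVar A :: G' => A :: var_types G'
  | ELock :: G' => var_types G'
  end.

Lemma var_types_app (Atom : Type) (G G' : ctx Atom) :
  var_types (G' ++ G) = var_types G' ++ var_types G.
Proof. induction G' as [|[]]; simpl; congruence. Qed.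

Lemma length_var_types (Atom : Type) (G : ctx Atom) :
  length (var_types G) = nvars G.
Proof. induction G as [|[]]; simpl; congruence. Qed.

Definition red_env (Atom : Type) (G : ctx Atom) (s : nat -> term) : Prop :=
  forall k A, nth_error (var_types G) k = Some A -> red A (s k).

(** The counterpart of [weaken]: a premise typed in [G] reads the environment past the variables of
    [G']. *)
Lemma red_env_app (Atom : Type) (G G' : ctx Atom) (s : nat -> term) :
  red_env (G' ++ G) s -> red_env G (fun k => s (nvars G' + k)).
Proof.
  intros H k A e. apply H. rewrite var_types_app, nth_error_app2;
    rewrite length_var_types; [|lia].
  rewrite <- e. f_equal. lia.
Qed.

(** The index [nvars G'] receives [a]; smaller indices read [s] at the same place and larger ones at
    their predecessor. *)
Lemma red_env_insert (Atom : Type) (G G' : ctx Atom) (A : ty Atom) s a :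
  red_env (G' ++ G) s -> red A a ->
  red_env (G' ++ EVar A :: G) (fun k => scons a s (to_front (nvars G') k)).
Proof.
  intros H Ha k B. rewrite var_types_app. unfold to_front.
  destruct (Nat.compare_spec k (nvars G')) as [-> |l|l]; intros e; simpl.
  - rewrite nth_error_app2 in e; rewrite length_var_types in *; [|lia].
    rewrite Nat.sub_diag in e. inversion e; subst; auto.
  - apply H. rewrite var_types_app. rewrite nth_error_app1 in *;
      rewrite ?length_var_types; auto.
  - destruct k as [|k]; [lia|]. simpl. apply H. rewrite var_types_app.
    rewrite nth_error_app2 in *; rewrite length_var_types in *; try lia.
    rewrite Nat.sub_succ_l in e by lia. exact e.
Qed.

Lemma subst0_bind_at (n : nat) (a : term) (s : nat -> term) (t : term) :
  subst0 a (subst (upsubst s) (bind_at n t))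
  = subst (fun k => scons a s (to_front n k)) t.
Proof.
  rewrite subst0_upsubst. unfold bind_at. apply subst_rename.
Qed.

(** Induction on the derivation, for all reducible environments at once: eliminations push their
    frame onto the stack, introductions analyse the stack they face. *)
Lemma red_has_type (Atom : Type) (G : ctx Atom) (t : term) (A : ty Atom) :
  has_type G t A -> forall s, red_env G s -> red A (subst s t).
Proof.
  induction 1 as [G G' A l|G|G t u A B _ IHt _ IHu|G t A B _ IH|G t A B _ IH
    |G t A B _ IH|G t u A B _ IHt _ IHu|G t A B _ IH|G t A B _ IH
    |G G' r t u A B C _ IHr _ IHt _ IHu|G G' t A _ IH|G t A _ IH
    |G G' t A l _ IH]; intros s Hs; simpl; unfold weaken; rewrite ?subst_rename.
  - apply Hs. rewrite var_types_app, nth_error_app2;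
      rewrite length_var_types; [|lia]. rewrite Nat.sub_diag. reflexivity.
  - intros K [-> |[]]. apply normalisable_Star.
  - specialize (IHt s Hs). specialize (IHu s Hs).
    intros K [-> |(K' & [[-> HK]|[-> HK]])].
    + apply normalisable_Pair; eapply red_normalisable; eauto.
    + apply normalisable_fst_pair; [auto|eapply red_normalisable; eauto].
    + apply normalisable_snd_pair; [eapply red_normalisable; eauto|auto].
  - intros K HK. apply (IH s Hs (FFst :: K)). right. eauto.
  - intros K HK. apply (IH s Hs (FSnd :: K)). right. eauto.
  - apply red_Lam. intros u Hu. rewrite subst0_upsubst. apply IH.
    intros [|k] B' e; simpl in *; [injection e as <-; exact Hu|]. apply Hs; auto.
  - intros K HK. apply (IHt s Hs (FApp (subst s u) :: K)). right.
    exists (subst s u), K. split; auto. split; auto. apply IHu; auto.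
  - apply red_Inl; auto.
  - apply red_Inr; auto.
  - apply red_Case with A B.
    + apply IHr, red_env_app, Hs.
    + intros a Ha. rewrite subst0_bind_at. apply IHt, red_env_insert; auto.
    + intros b Hb. rewrite subst0_bind_at. apply IHu, red_env_insert; auto.
  - apply red_Abort. apply IH, red_env_app, Hs.
  - specialize (IH s Hs). intros K [-> |(K' & -> & HK)].
    + apply normalisable_Shut. eapply red_normalisable; eauto.
    + apply normalisable_open_shut. auto.
  - intros K HK. apply (IH _ (red_env_app _ _ Hs) (FOpen :: K)). right. eauto.
Qed.

Theorem theorem3 (Atom : Type) (G : ctx Atom) (t : term) (A : ty Atom) :
  has_type G t A -> normalisable t.
Proof.
  intros H. apply red_normalisable with (A := A). rewrite <- (subst_Var t).
  (* The identity substitution is a reducible environment, because variables are reducible at every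
     type. *)
  apply (red_has_type H). intros k B _. apply red_Var.
Qed.
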